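(* Let $\sigma>0$, let $y\in\mathbb{R}$, and let $\mathcal{L}:\mathbb{R}\to\mathbb{R}$ be defined by $\mathcal{L}(x)=\mathbb{E}_{\epsilon\sim\mathcal{N}(0,\sigma^2)}\left[\left((x+\epsilon)^2-y^2\right)^2\right]$. If $y^2\leq 3\sigma^2$, then the only global minimizer of $\mathcal{L}$ is $0$. If $y^2>3\sigma^2$, then the global minimizers of $\mathcal{L}$ are exactly $\sqrt{y^2-3\sigma^2}$ and $-\sqrt{y^2-3\sigma^2}$.
   Context: This is the loss $\mathcal{L}(x)=\mathbb{E}_{\epsilon\sim p(\epsilon_0)}[\|\phi(x+\epsilon)-\phi(y)\|^2]$ for the representation $\phi(x)=x^2$ in dimension $1$, with centered Gaussian noise $\epsilon_0\sim\mathcal{N}(0,\sigma^2)$ of variance $\sigma^2$; $y$ is fixed (deterministic). *)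

(* Defs.v *)
From mathcomp Require Import all_boot all_order all_algebra.
From mathcomp Require Import all_classical all_reals all_analysis.
Set Implicit Arguments.
Unset Strict Implicit.
Unset Printing Implicit Defensive.
Import Order.TTheory GRing.Theory Num.Theory.
Import numFieldNormedType.Exports.
Local Open Scope classical_set_scope.
Local Open Scope ring_scope.

(* The second parameter of normal_prob is the standard deviation, so that
   normal_prob 0 sigma is N(0, sigma^2). Expectations take values in \bar R;
   the loss is not truncated to R with fine, as fine +oo = 0. *)
Definition loss (R : realType) (sigma y x : R) : \bar R :=
  ('E_(normal_prob 0%R sigma)
     [fun eps : R => (((x + eps) ^+ 2 - y ^+ 2) ^+ 2)%R])%E.

Definition global_minimizers (R : realType) (f : R -> \bar R) : set R :=
  [set x | forall z : R, (f x <= f z)%E].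

(* Main.v *)
Require Import Defs.
From mathcomp Require Import all_boot all_order all_algebra.
From mathcomp Require Import all_classical all_reals all_analysis.
From mathcomp Require Import measurable_realfun ring lra.
Import Order.TTheory GRing.Theory Num.Theory.
Import numFieldNormedType.Exports.
Local Open Scope classical_set_scope.
Local Open Scope ring_scope.

(* Integrating the derivative of [x ^+ n] times the Gaussian density over the
   line gives the recursion [M (n + 1) = s^2 * n * M (n - 1)] between the
   moments of N(0, s^2). Expanding the loss in these moments and completing the
   square gives [(x^2 - (y^2 - 3 s^2))^2 + 4 y^2 s^2 - 6 s^4], whose minimizers
   can be read off. *)

(** The change of variables holds for the Radon-Nikodym derivative [g]. The density [normal_pdf] has
    the same integral as [g] over every measurable set, so the two agree almost everywhere. *)
Lemma ge0_integral_normal_prob (R : realType) (m s : R) (f : R -> \bar R) :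
  (forall x, 0 <= f x)%E -> measurable_fun [set: R] f ->
  (\int[normal_prob m s]_x f x =
   \int[lebesgue_measure]_x (f x * (normal_pdf m s x)%:E))%E.
Proof.
move=> f0 mf; have dom := @normal_prob_dominates R m s.
have mpdf : measurable_fun [set: R] (EFin \o normal_pdf m s).
  by apply/measurable_EFinP; exact: measurable_normal_pdf.
pose g := Radon_Nikodym_SigmaFinite.f (normal_prob m s) (@lebesgue_measure R).
have ig : (@lebesgue_measure R).-integrable setT g.
  exact: Radon_Nikodym_SigmaFinite.f_integrable.
rewrite -(Radon_Nikodym_SigmaFinite.change_of_variables dom f0 measurableT mf).
apply: ae_eq_integral => //.
- by apply: emeasurable_funM => //; exact: measurable_int ig.
- exact: emeasurable_funM.
- apply: ae_eqe_mul2l; apply: integral_ae_eq => // E _ mE.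
  by rewrite -Radon_Nikodym_SigmaFinite.f_integral.
Qed.

(** The fundamental theorem of calculus applies on [[-n, n]], and dominated convergence with bound
    [|f|] passes to the whole line. Since [f] is integrable, limits of [F] along the integers
    suffice. *)
Lemma Rintegral_derive (R : realType) (F f : R -> R) (l l' : R) :
  continuous f -> (@lebesgue_measure R).-integrable setT (EFin \o f) ->
  (forall x, is_derive x (1 : R) F (f x)) ->
  (fun n : nat => F n%:R) @ \oo --> l ->
  (fun n : nat => F (- n%:R)) @ \oo --> l' ->
  \int[lebesgue_measure]_x f x = l - l'.
Proof.
move=> cf intf dF Fl Fl'.
pose I (n : nat) : set R := `[- n%:R, n%:R]%classic.
have cF : continuous F.
  by move=> x; apply/differentiable_continuous/derivable1_diffP.
(* The shift to [n.+1] keeps the interval nondegenerate, as [continuous_FTC2] requires. *)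
have intI : (fun n => \int[lebesgue_measure]_(x in I n.+1) (f x)%:E)%E =
    (fun n => (F n.+1%:R - F (- n.+1%:R))%:E).
  apply/funext => n; rewrite (@continuous_FTC2 _ f F)//.
  - by rewrite gtrN.
  - exact: continuous_subspaceT.
  - by split=> //; [exact/cvg_at_right_filter/cF|exact/cvg_at_left_filter/cF].
  - by move=> x _; rewrite derive1E derive_val.
have limF : (\int[lebesgue_measure]_(x in I n.+1) (f x)%:E @[n --> \oo] -->
    (l - l')%:E)%E.
  rewrite intI; apply: cvg_EFin; first by apply: nearW.
  by apply: cvgB; [rewrite (cvg_shiftS (fun n => F n%:R))|
                   rewrite (cvg_shiftS (fun n => F (- n%:R)))].
have mI n : measurable (I n) by exact: measurable_itv.
have limf : (\int[lebesgue_measure]_(x in I n.+1) (f x)%:E @[n --> \oo] -->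
    \int[lebesgue_measure]_x (f x)%:E)%E.
  rewrite (cvg_shiftS
    (fun n => \int[lebesgue_measure]_(x in I n) (f x)%:E)%E).
  rewrite (_ : (fun n => _) =
      (fun n => \int[lebesgue_measure]_x (((EFin \o f) \_ (I n)) x)))%E; last first.
    by apply/funext => n; rewrite integral_mkcond.
  have mf := measurable_int _ intf.
  apply: (@dominated_cvg _ _ _ lebesgue_measure setT measurableT
    (fun n => (EFin \o f) \_ (I n)) (EFin \o f) (abse \o (EFin \o f))) => //.
  - move=> n; apply/(measurable_restrictT (EFin \o f)) => //.
    exact: measurable_funTS.
  - move=> x _; apply: cvg_near_cst; near=> n; rewrite patchE mem_set//=.
    rewrite /I/= in_itv/= -ler_norml; near: n; exact: nbhs_infty_ger.
  - exact: integrable_abse.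
  - move=> n x _; rewrite patchE; case: ifPn => //= _.
    by rewrite normr0 lee_fin normr_ge0.
by rewrite /Rintegral (cvg_unique _ limf limF).
Unshelve. all: by end_near. Qed.

(* With [t = x^2 / (8 s^2)], the two densities are proportional to
   [expR (- 4 * t)] and [expR (- t)], while [t ^+ n <= n`! * expR t]. *)
Lemma normXn_normal_pdf_le (R : realType) (s : R) (n : nat) : 0 < s ->
  exists2 C : R, 0 <= C & forall x,
    `|x| ^+ n * normal_pdf 0 s x <= C * normal_pdf 0 (2 * s) x.
Proof.
move=> s0; have s20 : 0 < 8 * s ^+ 2 by rewrite mulr_gt0 ?exprn_gt0.
(* The summand 1 comes from [a <= 1 + a ^+ 2] with [a = |x| ^+ n]; the other one from
   [x ^+ 2 = 8 * s ^+ 2 * t] and the bound on [t ^+ n]. *)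
pose K : R := 1 + (8 * s ^+ 2) ^+ n * n`!%:R.
have K0 : 0 <= K by rewrite addr_ge0// mulr_ge0// exprn_ge0// ltW.
(* The factor 2 makes up for the peak, which halves when the deviation doubles. *)
exists (2 * K) => [|x]; first by rewrite mulr_ge0.
pose t := x ^+ 2 / (8 * s ^+ 2).
have t0 : 0 <= t by rewrite divr_ge0 ?sqr_ge0// ltW.
have sn0 : s != 0 by rewrite gt_eqF.
have p0 : 0 <= normal_peak s by exact: normal_peak_ge0.
have pK : normal_peak (2 * s) = normal_peak s / 2.
  rewrite /normal_peak exprMn -[in LHS]mulrnAr -mulrA sqrtrM ?sqr_ge0//.
  by rewrite sqrtr_sqr ger0_norm// mulrnAr invfM mulrC.
have xn : `|x| ^+ n <= K * expR t.
  have e1 : 1 <= expR t by rewrite -expR0 ler_expR.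
  have tn : t ^+ n <= n`!%:R * expR t.
    case: n => [|n] in K K0 *; first by rewrite expr0 fact0 mul1r.
    rewrite -ler_pdivrMl ?ltr0n ?fact_gt0// mulrC.
    by apply: le_trans (expR_ge1Dxn n t0); rewrite lerDr.
  have x2n : `|x| ^+ n <= 1 + (x ^+ 2) ^+ n.
    rewrite -[x ^+ 2]real_normK ?num_real// exprAC.
    have := sqr_ge0 (`|x| ^+ n - 1); have : 0 <= `|x| ^+ n by rewrite exprn_ge0.
    nra.
  rewrite (le_trans x2n)// mulrDl mul1r lerD//.
  have -> : x ^+ 2 = (8 * s ^+ 2) * t by rewrite mulrC divfK// gt_eqF.
  by rewrite exprMn -mulrA ler_wpM2l// exprn_ge0// ltW.
rewrite !normal_pdfE ?mulf_neq0// pK /normal_fun !subr0.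
have -> : - x ^+ 2 / (s ^+ 2 *+ 2) = - (4 * t).
  by rewrite /t; field.
have -> : - x ^+ 2 / ((2 * s) ^+ 2 *+ 2) = - t.
  by rewrite /t; field.
rewrite [leRHS](_ : _ = normal_peak s * (K * expR (- t))); last by field.
rewrite mulrCA ler_wpM2l//.
(* What remains is [expR (t - 4 * t) <= expR (- t)], true as [t >= 0]. *)
apply: (@le_trans _ _ (K * expR t * expR (- (4 * t)))).
  by rewrite ler_wpM2r ?expR_ge0.
rewrite -mulrA ler_wpM2l// -expRD ler_expR; lra.
Qed.

Lemma continuous_Xn_normal_pdf (R : realType) (s : R) (n : nat) : 0 < s ->
  continuous (fun x : R => x ^+ n * normal_pdf 0 s x).
Proof.
move=> s0 x; apply: cvgM; first exact: exprn_continuous.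
by apply: continuous_normal_pdf; rewrite gt_eqF.
Qed.

Lemma integrable_Xn_normal_pdf (R : realType) (s : R) (n : nat) : 0 < s ->
  (@lebesgue_measure R).-integrable setT
    (EFin \o (fun x : R => x ^+ n * normal_pdf 0 s x)).
Proof.
move=> s0; have [C C0 leC] := normXn_normal_pdf_le R s n s0.
apply: (@le_integrable _ _ _ lebesgue_measure setT measurableT _
  (fun x => (C * normal_pdf 0 (2 * s) x)%:E)).
- apply/measurable_EFinP; apply: continuous_measurable_fun.
  exact: continuous_Xn_normal_pdf.
- move=> x _ /=; rewrite lee_fin normrM normrX.
  rewrite (ger0_norm (normal_pdf_ge0 _ _ _)) (le_trans (leC x))//.
  exact: ler_norm.
- exact: (integrableZl measurableT C (integrable_normal_pdf 0 (2 * s))).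
Qed.

(** The domination is used with exponent [n.+1]: the spare factor [|x|] and the boundedness of the
    wider density leave a bound [D / |x|]. The sign [e] treats both ends of the line at once. *)
Lemma cvg_Xn_normal_pdf (R : realType) (s : R) (n : nat) (e : R) :
  0 < s -> `|e| = 1 ->
  (fun k : nat => (e * k%:R) ^+ n * normal_pdf 0 s (e * k%:R)) @ \oo -->
    (0 : R).
Proof.
move=> s0 e1; have [C C0 leC] := normXn_normal_pdf_le R s n.+1 s0.
have s20 : 2 * s != 0 by rewrite mulf_neq0 ?gt_eqF.
pose D := C * normal_peak (2 * s).
have cD : (fun k : nat => D * k.+1%:R^-1) @ \oo --> (0 : R).
  by rewrite -(mulr0 D); apply: cvgMr; exact: cvg_harmonic.
rewrite -cvg_shiftS; apply/cvgr0Pnorm_le => eps eps0.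
move/cvgr0Pnorm_le: cD => /(_ _ eps0); apply: filterS => k.
apply: le_trans; rewrite normrM normrX (ger0_norm (normal_pdf_ge0 _ _ _)).
set x := e * k.+1%:R.
have nx : `|x| = k.+1%:R by rewrite normrM e1 mul1r ger0_norm.
rewrite (le_trans _ (ler_norm _))// ler_pdivlMr// -nx mulrAC -exprSr.
by rewrite (le_trans (leC x))// ler_wpM2l// normal_pdf_ub.
Qed.

Lemma is_derive_normal_pdf (R : realType) (s x : R) : 0 < s ->
  is_derive x (1 : R) (normal_pdf 0 s) (- (x / s ^+ 2) * normal_pdf 0 s x).
Proof.
move=> s0; have sn0 : s != 0 by rewrite gt_eqF.
rewrite normal_pdfE//.
have -> : (fun x => normal_peak s * normal_fun 0 s x) =
    (fun x => normal_peak s * expR (- x ^+ 2 / (s ^+ 2 *+ 2))).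
  by apply/funext => z; rewrite /normal_fun subr0.
apply: is_derive_eq; rewrite /normal_fun subr0 /GRing.scale/=; field.
exact: sn0.
Qed.

Definition normal_moment (R : realType) (s : R) (n : nat) : R :=
  \int[lebesgue_measure]_x (x ^+ n * normal_pdf 0 s x).

Lemma normal_moment0 (R : realType) (s : R) : normal_moment R s 0 = 1.
Proof.
rewrite /normal_moment; under eq_Rintegral do rewrite expr0 mul1r.
by rewrite /Rintegral integral_normal_pdf.
Qed.

(** At [n = 0] the factor [n%:R] cancels the junk value [n.-1 = 0], and the first moment is 0. *)
Lemma normal_momentS (R : realType) (s : R) (n : nat) : 0 < s ->
  normal_moment R s n.+1 = s ^+ 2 * n%:R * normal_moment R s n.-1.
Proof.
move=> s0; have sn0 : s != 0 by rewrite gt_eqF.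
pose p := normal_pdf 0 s.
(* This is the derivative of [s ^+ 2 * (x ^+ n * p x)]; the factor [s ^+ 2] clears the denominator
   in the derivative of [p]. *)
pose f (x : R) := (s ^+ 2 * n%:R) * (x ^+ n.-1 * p x) - x ^+ n.+1 * p x.
have iX k := integrable_Xn_normal_pdf R s k s0.
have ic : lebesgue_measure.-integrable setT
    (EFin \o (fun x => (s ^+ 2 * n%:R) * (x ^+ n.-1 * p x))).
  exact: (integrableZl measurableT _ (iX n.-1)).
have : \int[lebesgue_measure]_x f x = 0 - 0.
  apply: (@Rintegral_derive _ (fun x => s ^+ 2 * (x ^+ n * p x))).
  - move=> x; apply: cvgB; last exact: continuous_Xn_normal_pdf.
    by apply: cvgM; [exact: cvg_cst|exact: continuous_Xn_normal_pdf].
  - exact: (integrableB measurableT ic (iX n.+1)).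
  - move=> x; have dp := is_derive_normal_pdf R s x s0.
    have dX : is_derive x (1 : R) (fun x => x ^+ n) (n%:R * x ^+ n.-1).
      by split; [exact: exprn_derivable|rewrite exp_derive /GRing.scale/= mulr1].
    have dF := is_deriveZ (s ^+ 2) (is_deriveM dX dp).
    apply: (is_derive_eq dF).
    rewrite /GRing.scale/= /f /p (exprS x n).
    (* The identity is linear in these two powers, so they can be treated as independent atoms. *)
    move: (x ^+ n) (x ^+ n.-1) => a b; field.
    exact: sn0.
  - rewrite -(mulr0 (s ^+ 2)); apply: cvgMr.
    have := cvg_Xn_normal_pdf R s n 1 s0 (normr1 _).
    by under eq_cvg do rewrite mul1r.
  - rewrite -(mulr0 (s ^+ 2)); apply: cvgMr.
    have := cvg_Xn_normal_pdf R s n (-1) s0 (normrN1 _).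
    by under eq_cvg do rewrite mulN1r.
rewrite subr0 /f (RintegralB measurableT ic (iX n.+1)).
by rewrite (RintegralZl _ measurableT (iX n.-1)) => /subr0_eq/esym.
Qed.

Lemma integral_sum_normal_pdf (R : realType) (s : R) (c : nat -> R) (n : nat) :
  0 < s ->
  (\int[lebesgue_measure]_x ((\sum_(i < n) c i * x ^+ i) * normal_pdf 0 s x)%:E =
   (\sum_(i < n) c i * normal_moment R s i)%:E)%E.
Proof.
move=> s0; have iX k := integrable_Xn_normal_pdf R s k s0.
under eq_integral => x _.
  rewrite mulr_suml -sumEFin; under eq_bigr do rewrite -mulrA EFinM.
  over.
rewrite integral_sum//; last first.
  by move=> i; exact: (integrableZl measurableT (c i) (iX i)).
rewrite -sumEFin; apply: eq_bigr => i _.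
rewrite (integralZl measurableT (iX i)) EFinM; congr (_ * _)%E.
(* Integrability makes the integral finite, so the [fine] in the moment loses nothing. *)
by rewrite /normal_moment /Rintegral fineK// (integrable_fin_num measurableT (iX i)).
Qed.

Lemma lossE (R : realType) (s y x : R) : 0 < s ->
  loss s y x = ((x ^+ 2 - (y ^+ 2 - 3 * s ^+ 2)) ^+ 2 +
    (4 * y ^+ 2 * s ^+ 2 - 6 * s ^+ 4))%:E.
Proof.
move=> s0; rewrite /loss unlock ge0_integral_normal_prob; last 2 first.
- by move=> e; rewrite lee_fin sqr_ge0.
- apply/measurable_EFinP; apply: measurable_funX; apply: measurable_funB => //.
  by apply: measurable_funX; exact: measurable_funD.
(* Coefficients of [((x + e) ^+ 2 - y ^+ 2) ^+ 2] in increasing powers of [e]. *)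
pose c := [:: (x ^+ 2 - y ^+ 2) ^+ 2; 4 * x * (x ^+ 2 - y ^+ 2);
              6 * x ^+ 2 - 2 * y ^+ 2; 4 * x; 1].
under eq_integral => e _.
  rewrite -EFinM [X in X * _](_ : _ = \sum_(i < 5) c`_i * e ^+ i); last first.
    by rewrite !big_ord_recl big_ord0/=; ring.
  over.
rewrite (integral_sum_normal_pdf R s (nth 0 c) 5 s0) !big_ord_recl big_ord0/=.
(* The recursion gives the moments 1, 0, [s ^+ 2], 0, [3 * s ^+ 4]. *)
by rewrite /bump/= !normal_momentS//= normal_moment0; congr EFin; ring.
Qed.

(* The first conjunct is the well-definedness of the loss as a map R -> R. *)
Theorem proposition2p2 (R : realType) (sigma y : R) (sigma_gt0 : 0 < sigma) :
  [/\ forall x : R, loss sigma y x \is a fin_num,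
      y ^+ 2 <= 3 * sigma ^+ 2 ->
        global_minimizers (loss sigma y) = [set 0]
    & 3 * sigma ^+ 2 < y ^+ 2 ->
        global_minimizers (loss sigma y) =
          [set Num.sqrt (y ^+ 2 - 3 * sigma ^+ 2);
               - Num.sqrt (y ^+ 2 - 3 * sigma ^+ 2)]].
Proof.
set a := y ^+ 2 - 3 * sigma ^+ 2.
(* The part of the loss independent of [x] cancels in comparisons. *)
have le_loss u v : (loss sigma y u <= loss sigma y v)%E =
    ((u ^+ 2 - a) ^+ 2 <= (v ^+ 2 - a) ^+ 2).
  by rewrite !lossE// lee_fin lerD2r.
split=> [x||]; first by rewrite lossE.
- rewrite -subr_le0 -/a => a0; apply/seteqP; split=> [x /(_ 0)|_ -> z] /=.
    (* Comparison with 0 gives [x ^+ 2 * (x ^+ 2 - 2 * a) <= 0], which forces [x ^+ 2 <= 0] because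
       [a <= 0]. *)
    rewrite le_loss expr0n/= => h.
    apply/eqP; rewrite -sqrf_eq0 eq_le sqr_ge0 andbT.
    by have := sqr_ge0 x; nra.
  by rewrite le_loss expr0n/=; have := sqr_ge0 z; nra.
- rewrite -subr_gt0 -/a => a0.
  have sqa : Num.sqrt a ^+ 2 = a by rewrite sqr_sqrtr// ltW.
  apply/seteqP; split=> [x /(_ (Num.sqrt a))|x [] -> z] /=.
  (* At [Num.sqrt a] the square vanishes, so it must vanish at every minimizer. *)
  + rewrite le_loss sqa subrr expr0n/= => h.
    have /eqP : x ^+ 2 - a = 0.
      by apply/eqP; rewrite -sqrf_eq0 eq_le h sqr_ge0.
    by rewrite -[X in _ - X]sqa subr_eq0 eqf_sqr => /orP[]/eqP; [left|right].
  + by rewrite le_loss sqa subrr expr0n/= sqr_ge0.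
  + by rewrite le_loss sqrrN sqa subrr expr0n/= sqr_ge0.
Qed.
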